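(* Let $p>1$ and let $\{(x_i,y_i)\}_{i=1}^n\subset\mathbb{R}^d\times\{\pm1\}$ be linearly separable, i.e. there is $w^*\in\mathbb{R}^d$ with $\mathrm{sign}(\langle w^*,x_i\rangle)=y_i$ for all $i$, and assume there is a constant $C$ with $\max_i\|x_i\|_q<C$, where $1/p+1/q=1$. Let $L(w)=\frac1n\sum_{i=1}^n\ell(y_i\langle w,x_i\rangle)$, where $\ell:\mathbb{R}\to\mathbb{R}$ is differentiable, decreasing, convex, does not attain its minimum, and $\inf\ell=0$. Suppose the regularized direction $\bar w^{\mathrm{reg}}_p$ with respect to the $\ell_p$-norm exists. Then for sufficiently small step size $\eta>0$, the iterates $w_t$ of $p$-GD satisfy $$\lim_{t\to\infty}\frac{w_t}{\|w_t\|_p}=\bar w^{\mathrm{reg}}_p.$$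
   Context: $p$-GD is mirror descent with potential $\psi(w)=\frac1p\|w\|_p^p$, i.e. from an initialization $w_0\in\mathbb{R}^d$, the update $\nabla\psi(w_{t+1})=\nabla\psi(w_t)-\eta\nabla L(w_t)$, which coordinatewise reads: $w_t^+[j]=|w_t[j]|^{p-1}\mathrm{sign}(w_t[j])-\eta\nabla L(w_t)[j]$ and $w_{t+1}[j]=|w_t^+[j]|^{1/(p-1)}\mathrm{sign}(w_t^+[j])$. The regularization path is $\bar w_p(B)=\arg\min_{\|w\|_p\le B}L(w)$ for $B>0$; if the limit $\lim_{B\to\infty}\bar w_p(B)/B$ exists, it is called the regularized direction and denoted $\bar w^{\mathrm{reg}}_p$. *)

(* Defs.v *)
From HB Require Import structures.
From mathcomp Require Import all_boot all_order all_algebra.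
From mathcomp Require Import all_classical all_reals all_analysis.
Set Implicit Arguments. Unset Strict Implicit. Unset Printing Implicit Defensive.
Import Order.TTheory GRing.Theory Num.Theory.
Import numFieldNormedType.Exports.
Local Open Scope classical_set_scope.
Local Open Scope ring_scope.

Section PGD.
Variable R : realType.

Definition dotv (d : nat) (u v : 'rV[R]_d) : R := \sum_(j < d) u 0 j * v 0 j.

Definition pnorm (d : nat) (p : R) (w : 'rV[R]_d) : R :=
  (\sum_(j < d) `|w 0 j| `^ p) `^ p^-1.

Definition emp_loss (n d : nat) (ell : R -> R) (x : 'I_n -> 'rV[R]_d)
    (y : 'I_n -> R) (w : 'rV[R]_d) : R :=
  n%:R^-1 * \sum_(i < n) ell (y i * dotv w (x i)).

Definition grad (d : nat) (L : 'rV[R]_d -> R) (w : 'rV[R]_d) : 'rV[R]_d :=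
  \row_(j < d) 'D_(delta_mx 0 j) L w.

(* one step of p-GD (mirror descent with psi(w) = 1/p ||w||_p^p) *)
Definition pGD_step (d : nat) (p eta : R) (L : 'rV[R]_d -> R) (w : 'rV[R]_d)
  : 'rV[R]_d :=
  \row_(j < d)
    let wplus := `|w 0 j| `^ (p - 1) * Num.sg (w 0 j) - eta * grad L w 0 j in
    `|wplus| `^ (p - 1)^-1 * Num.sg wplus.

Definition pGD (d : nat) (p eta : R) (L : 'rV[R]_d -> R) (w0 : 'rV[R]_d)
  (t : nat) : 'rV[R]_d := iter t (pGD_step p eta L) w0.

Definition is_reg_path (d : nat) (p : R) (L : 'rV[R]_d -> R)
  (wbar : R -> 'rV[R]_d) : Prop :=
  forall B, 0 < B ->
    pnorm p (wbar B) <= B /\ (forall w, pnorm p w <= B -> L (wbar B) <= L w).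

Definition is_reg_direction (d : nat) (p : R) (L : 'rV[R]_d -> R)
  (r : 'rV[R]_d) : Prop :=
  exists wbar : R -> 'rV[R]_d, is_reg_path p L wbar /\
    (B^-1 *: wbar B @[B --> +oo] --> r).

Definition convex_fun (f : R -> R) : Prop :=
  forall a b t, 0 <= t <= 1 -> f (t * a + (1 - t) * b) <= t * f a + (1 - t) * f b.

Definition admissible_loss (ell : R -> R) : Prop :=
  [/\ (forall a, derivable ell a 1),
      (forall a b, a < b -> ell b < ell a),
      convex_fun ell,
      (forall a, exists b, ell b < ell a) &
      ((forall a, 0 <= ell a) /\ (forall e, 0 < e -> exists a, ell a < e))].

End PGD.

(* Main.v *)
(* Work with the dual iterates [th_t = nabla psi(w_t)], which move by [-eta nabla L(w_t)], and write
   [N] for the [l_q]-norm, whose gradient at [th_t] is [w_t / ||w_t||_p]. Convexity of [N] bounds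
   [N(th_(t+1)) - N(th_t)] by the pairing of the step with this gradient at [th_(t+1)], hence, up to
   an error which is small compared with the step once [N(th_t)] is large, at [th_t]. By convexity
   of [L] and minimality of the regularization path at radius [||w_t||_p], the latter pairing is at
   most that of the step with [r], up to a small error again. All errors are absorbed by pairing the
   step with a separator [w*], so [N(th) - <th, r + e w*>] is eventually nonincreasing for every
   [e > 0]. As [N(th_t)] tends to infinity, [<th_t, r> / N(th_t)] tends to [1], and equality in
   Hoelder's inequality identifies the limit of [w_t / ||w_t||_p] as [r]. Smoothness of the loss
   plays no role: a small [eta] is only needed to keep the steps bounded, and this follows from the same
   potential because [r] has positive margin. *)
Require Import Defs.
From HB Require Import structures.
From mathcomp Require Import all_boot all_order all_algebra.
From mathcomp Require Import all_classical all_reals all_analysis.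
From mathcomp Require Import ring lra.
Set Implicit Arguments. Unset Strict Implicit. Unset Printing Implicit Defensive.
Import Order.TTheory GRing.Theory Num.Theory.
Import numFieldNormedType.Exports.
Local Open Scope classical_set_scope.
Local Open Scope ring_scope.

(** * Signed powers *)

Section SignedPower.
Variable R : realType.
Implicit Types a b c s e : R.

(** For [s = p - 1] this is the derivative of [|a|^p / p], hence one coordinate of the mirror
    map. *)
Definition spow s a : R := `|a| `^ s * Num.sg a.

Lemma spow0 s : spow s 0 = 0.
Proof. by rewrite /spow sgr0 mulr0. Qed.

Lemma normr_spow s a : s != 0 -> `|spow s a| = `|a| `^ s.
Proof.
move=> s0; rewrite /spow normrM normr_sg (ger0_norm (powR_ge0 _ _)).
have [->|_] := eqVneq a 0; first by rewrite normr0 powR0// mul0r.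
by rewrite mulr1.
Qed.

Lemma sgr_spow s a : Num.sg (spow s a) = Num.sg a.
Proof.
rewrite /spow sgrM sgr_id; have [->|a0] := eqVneq a 0; first by rewrite sgr0 mulr0.
by rewrite gtr0_sg ?mul1r// powR_gt0// normr_gt0.
Qed.

Lemma spowK s a : 0 < s -> spow s^-1 (spow s a) = a.
Proof.
move=> s0; rewrite {1}/spow sgr_spow normr_spow ?gt_eqF// -powRrM.
by rewrite mulfV ?gt_eqF// powRr1// mulrC mulr_sg_norm.
Qed.

Lemma spowVK s a : 0 < s -> spow s (spow s^-1 a) = a.
Proof. by move=> s0; rewrite -{1}(invrK s) spowK// invr_gt0. Qed.

Lemma spowN s a : spow s (- a) = - spow s a.
Proof. by rewrite /spow normrN sgrN mulrN. Qed.

Lemma spow_nneg s a : 0 < s -> 0 <= a -> spow s a = a `^ s.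
Proof.
move=> s0 a0; rewrite /spow ger0_norm//.
have [->|an0] := eqVneq a 0; first by rewrite powR0 ?mul0r ?gt_eqF.
by rewrite gtr0_sg ?mulr1// lt0r an0.
Qed.

Lemma spow_ltr s a b : 0 < s -> a < b -> spow s a < spow s b.
Proof.
move=> s0.
have pos c e : 0 <= c -> c < e -> spow s c < spow s e.
  move=> c0 ce; have e0 := le_lt_trans c0 ce.
  by rewrite !spow_nneg ?(ltW e0)// gt0_ltr_powR// nnegrE ltW.
move=> ab; have [a0|a0] := leP 0 a; first exact: pos.
have [b0|b0] := ltP b 0.
  by rewrite -[a]opprK -[b]opprK !(spowN s (- _)) ltrN2 pos ?ltrN2// oppr_ge0 ltW.
apply: (@lt_le_trans _ _ 0).
  by rewrite -[a]opprK spowN oppr_lt0 -(spow0 s) pos ?oppr_gt0.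
by rewrite spow_nneg// powR_ge0.
Qed.

Lemma spow_ler s a b : 0 < s -> a <= b -> spow s a <= spow s b.
Proof.
by move=> s0; rewrite le_eqVlt => /predU1P[->//|ab]; exact/ltW/spow_ltr.
Qed.

Lemma spow_ltrP s a b : 0 < s -> (spow s a < b) = (a < spow s^-1 b).
Proof.
move=> s0; apply/idP/idP => h.
  by rewrite -[a](spowK _ s0) spow_ltr// invr_gt0.
by rewrite -[b](spowVK _ s0) spow_ltr.
Qed.

Lemma spow_gtrP s a b : 0 < s -> (b < spow s a) = (spow s^-1 b < a).
Proof.
move=> s0; apply/idP/idP => h.
  by rewrite -[a](spowK _ s0) spow_ltr// invr_gt0.
by rewrite -[b](spowVK _ s0) spow_ltr.
Qed.

Lemma spowM s c a : 0 <= c -> s != 0 -> spow s (c * a) = c `^ s * spow s a.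
Proof.
move=> c0 s0; rewrite /spow normrM (ger0_norm c0) powRM// sgrM.
have [->|cn0] := eqVneq c 0; first by rewrite powR0// !mul0r.
by rewrite (@gtr0_sg _ c) ?lt0r ?cn0// mul1r mulrA.
Qed.

Lemma mulr_spow s a : 0 < s -> a * spow s a = `|a| `^ (s + 1).
Proof.
move=> s0; rewrite /spow mulrCA [a * _]mulrC -normrEsg.
by rewrite powRD ?powRr1// gt_eqF// addr_gt0.
Qed.

(** An increasing bijection is continuous: the values [y] with [spow s y] within [e] of [spow s x]
    form an open interval whose ends are given by the inverse power. *)
Lemma continuous_spow s : 0 < s -> continuous (spow s).
Proof.
move=> s0 x; apply/cvgrPdist_lt => e e0.
have h1 : spow s^-1 (spow s x - e) < x by rewrite -spow_gtrP// gtrBl.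
have h2 : x < spow s^-1 (spow s x + e) by rewrite -spow_ltrP// ltrDl.
near=> y.
have : spow s x - e < spow s y by rewrite spow_gtrP//; near: y; exact: lt_nbhsr.
have : spow s y < spow s x + e by rewrite spow_ltrP//; near: y; exact: lt_nbhsl.
by rewrite ltr_norml; lra.
Unshelve. all: by end_near. Qed.

End SignedPower.

(** Only [x] is confined to the segment, so the perturbed point [y] need not be located. Compactness
    in near-covering form, with [del] tending to [0] from the right, gives one [del] for the whole
    segment. *)
Lemma heine_cantor (R : realType) (f : R -> R) (a b : R) : continuous f ->
  forall e, 0 < e -> exists2 del, 0 < del &
    forall x y, a <= x <= b -> `|x - y| < del -> `|f x - f y| < e.
Proof.
move=> fc e e0.
pose P (del x : R) := forall y, `|x - y| < del -> `|f x - f y| < e.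
have /compact_near_coveringP/(_ _ (0 : R)^'+ P) := @segment_compact R a b.
case.
- move=> x _; have e20 : 0 < e / 2 by rewrite divr_gt0.
  have /cvgrPdist_lt/(_ _ e20)/nbhs_ballP[r /= r0 hr] := fc x.
  exists (ball x (r / 2), [set del | del < r / 2]) => /=.
    split; first by apply: nbhsx_ballx; rewrite divr_gt0.
    by apply: nbhs_right_lt; rewrite divr_gt0.
  move=> [x' del] /= [xx' dr] y yx'.
  have h1 : `|f x - f x'| < e / 2.
    by apply: hr; rewrite /ball /= in xx' *; lra.
  have h2 : `|f x - f y| < e / 2.
    apply: hr; rewrite /ball /= in xx' *.
    have := ler_distD x' x y; lra.
  have := ler_distD (f x) (f x') (f y); rewrite (distrC (f x') (f x)); lra.
- move=> r /= r0 hr; exists (r / 2); first by rewrite divr_gt0.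
  move=> x y xab xy; apply: (hr (r / 2)) => //=; rewrite ?divr_gt0//.
  by rewrite /ball/= sub0r normrN gtr0_norm ?divr_gt0// ltr_pdivrMr// ltr_pMr// ltr1n.
Qed.

(** * Norms and their duality *)

(* A sealed copy of [pnorm]: unification would otherwise unfold [powR] down to limits of series. *)
HB.lock Definition lpnorm (R : realType) (d : nat) (p : R) (w : 'rV[R]_d) : R := pnorm p w.
Arguments lpnorm {R d}.

Section DualNorm.
Variable R : realType.
Implicit Types p q : R.

Lemma lpnormE d p (w : 'rV[R]_d) :
  lpnorm p w = (\sum_(j < d) `|w 0 j| `^ p) `^ p^-1.
Proof. by rewrite lpnorm.unlock. Qed.

Lemma lpnorm_ge0 d p (w : 'rV[R]_d) : 0 <= lpnorm p w.
Proof. by rewrite lpnormE powR_ge0. Qed.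

Lemma sum_powR_ge0 d p (w : 'rV[R]_d) : 0 <= \sum_(j < d) `|w 0 j| `^ p.
Proof. by apply: sumr_ge0 => j _; exact: powR_ge0. Qed.

Lemma lpnorm_powR d p (w : 'rV[R]_d) : p != 0 ->
  lpnorm p w `^ p = \sum_(j < d) `|w 0 j| `^ p.
Proof. by move=> p0; rewrite lpnormE -powRrM mulVf// powRr1// sum_powR_ge0. Qed.

Lemma ler_lpnorm d p (w : 'rV[R]_d) j : 0 < p -> `|w 0 j| <= lpnorm p w.
Proof.
move=> p0; rewrite lpnormE -[leLHS]powRr1// -(mulfV (lt0r_neq0 p0)) powRrM.
apply: ge0_ler_powR; rewrite ?nnegrE ?powR_ge0 ?sum_powR_ge0 ?invr_ge0 ?(ltW p0)//.
rewrite (bigD1 j)//= lerDl.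
by apply: sumr_ge0 => i _; exact: powR_ge0.
Qed.

Lemma lpnorm_le1 d p (w : 'rV[R]_d) : 0 < p ->
  (lpnorm p w <= 1) = (\sum_(j < d) `|w 0 j| `^ p <= 1).
Proof.
move=> p0; apply/idP/idP => h.
  rewrite -lpnorm_powR ?gt_eqF// -[leRHS](congr1 (@^~ p) (powR1 R)).
  by apply: ge0_ler_powR; rewrite ?nnegrE ?lpnorm_ge0 ?(ltW p0).
rewrite lpnormE -[leRHS](congr1 (@^~ p^-1) (powR1 R)).
by apply: ge0_ler_powR; rewrite ?nnegrE ?sum_powR_ge0 ?invr_ge0 ?(ltW p0).
Qed.

Lemma lpnormZ d p c (w : 'rV[R]_d) : p != 0 -> lpnorm p (c *: w) = `|c| * lpnorm p w.
Proof.
move=> p0; rewrite !lpnormE.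
under eq_bigr do rewrite mxE normrM powRM//.
rewrite -mulr_sumr powRM ?powR_ge0 ?sum_powR_ge0//.
by rewrite -powRrM mulfV// powRr1.
Qed.

Lemma dotvC d (u v : 'rV[R]_d) : dotv u v = dotv v u.
Proof. by apply: eq_bigr => j _; rewrite mulrC. Qed.

Lemma dotvDl d (u v w : 'rV[R]_d) : dotv (u + v) w = dotv u w + dotv v w.
Proof. by rewrite -big_split; apply: eq_bigr => j _; rewrite mxE mulrDl. Qed.

Lemma dotvDr d (u v w : 'rV[R]_d) : dotv w (u + v) = dotv w u + dotv w v.
Proof. by rewrite dotvC dotvDl !(dotvC w). Qed.

Lemma dotvZl d c (u w : 'rV[R]_d) : dotv (c *: u) w = c * dotv u w.
Proof. by rewrite /dotv mulr_sumr; apply: eq_bigr => j _; rewrite mxE mulrA. Qed.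

Lemma dotvZr d c (u w : 'rV[R]_d) : dotv w (c *: u) = c * dotv w u.
Proof. by rewrite dotvC dotvZl dotvC. Qed.

Lemma dotvBl d (u v w : 'rV[R]_d) : dotv (u - v) w = dotv u w - dotv v w.
Proof. by rewrite -scaleN1r dotvDl dotvZl mulN1r. Qed.

Lemma dotvBr d (u v w : 'rV[R]_d) : dotv w (u - v) = dotv w u - dotv w v.
Proof. by rewrite dotvC dotvBl !(dotvC w). Qed.

Lemma dotv_suml d n (f : 'I_n -> 'rV[R]_d) (w : 'rV[R]_d) :
  dotv (\sum_i f i) w = \sum_i dotv (f i) w.
Proof.
rewrite /dotv exchange_big /=; apply: eq_bigr => j _.
by rewrite summxE mulr_suml.
Qed.

(** Steps are measured in this norm because it is dual to coordinatewise bounds on directions. *)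
Definition l1norm d (u : 'rV[R]_d) : R := \sum_(j < d) `|u 0 j|.

Lemma l1norm_ge0 d (u : 'rV[R]_d) : 0 <= l1norm u.
Proof. exact: sumr_ge0. Qed.

Lemma l1normZ d c (u : 'rV[R]_d) : l1norm (c *: u) = `|c| * l1norm u.
Proof. by rewrite /l1norm mulr_sumr; apply: eq_bigr => j _; rewrite mxE normrM. Qed.

Lemma l1normN d (u : 'rV[R]_d) : l1norm (- u) = l1norm u.
Proof. by rewrite -scaleN1r l1normZ normrN normr1 mul1r. Qed.

Lemma l1normD d (u v : 'rV[R]_d) : l1norm (u + v) <= l1norm u + l1norm v.
Proof. by rewrite -big_split; apply: ler_sum => j _; rewrite mxE ler_normD. Qed.

Lemma l1norm_sum d n (f : 'I_n -> 'rV[R]_d) : l1norm (\sum_i f i) <= \sum_i l1norm (f i).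
Proof.
rewrite /l1norm exchange_big /=; apply: ler_sum => j _.
by rewrite summxE; exact: ler_norm_sum.
Qed.

Lemma le_l1norm d (u : 'rV[R]_d) j : `|u 0 j| <= l1norm u.
Proof. by rewrite /l1norm (bigD1 j)//= lerDl sumr_ge0. Qed.

Lemma ler_dotv_l1norm d (u v : 'rV[R]_d) c : (forall j, `|v 0 j| <= c) ->
  `|dotv u v| <= c * l1norm u.
Proof.
move=> vc; apply: le_trans (ler_norm_sum _ _ _) _.
rewrite mulr_sumr; apply: ler_sum => j _.
by rewrite normrM mulrC ler_wpM2r.
Qed.

(** Young's inequality, summed over the coordinates after scaling both vectors to norm [1]. *)
Lemma hoelder_dotv d p q (u v : 'rV[R]_d) : 0 < p -> 0 < q -> p^-1 + q^-1 = 1 ->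
  dotv u v <= lpnorm p u * lpnorm q v.
Proof.
move=> p0 q0 pq.
have [u0|u0] := leP (lpnorm p u) 0.
  rewrite /dotv big1 ?mulr_ge0 ?lpnorm_ge0// => j _.
  have /eqP -> : u 0 j == 0; last by rewrite mul0r.
  by rewrite -normr_le0 (le_trans (ler_lpnorm _ _ p0)).
have [v0|v0] := leP (lpnorm q v) 0.
  rewrite /dotv big1 ?mulr_ge0 ?lpnorm_ge0// => j _.
  have /eqP -> : v 0 j == 0; last by rewrite mulr0.
  by rewrite -normr_le0 (le_trans (ler_lpnorm _ _ q0)).
have unit r (w : 'rV[R]_d) : 0 < r -> 0 < lpnorm r w ->
    \sum_(j < d) (`|w 0 j| / lpnorm r w) `^ r = 1.
  move=> r0 w0; under eq_bigr do rewrite powRM ?invr_ge0 ?lpnorm_ge0//.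
  rewrite -mulr_suml -lpnorm_powR ?gt_eqF// -powRM ?lpnorm_ge0 ?invr_ge0 ?lpnorm_ge0//.
  by rewrite divff ?gt_eqF// powR1.
have := unit _ _ q0 v0; have := unit _ _ p0 u0 => {unit}.
move: (lpnorm p u) (lpnorm q v) u0 v0 => N M N0 M0 unitu unitv.
rewrite -[leRHS]mul1r -ler_pdivrMr ?mulr_gt0// /dotv mulr_suml.
apply: (@le_trans _ _ (\sum_(j < d) ((`|u 0 j| / N) `^ p / p +
                                      (`|v 0 j| / M) `^ q / q))).
  apply: ler_sum => j _; rewrite invfM mulrACA.
  apply: le_trans (ler_norm _) _; rewrite normrM !normf_div.
  by rewrite (gtr0_norm N0) (gtr0_norm M0) conjugate_powR ?divr_ge0 ?(ltW N0) ?(ltW M0).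
by rewrite big_split/= -!mulr_suml unitu unitv !mul1r pq.
Qed.

End DualNorm.

(** * The mirror map *)

Section MirrorMap.
Variables (R : realType) (p : R).
Hypothesis p1 : 1 < p.
Let q := p / (p - 1).

Let p0 : 0 < p. Proof. exact: lt_trans ltr01 p1. Qed.
Let s0 : 0 < p - 1. Proof. by rewrite subr_gt0. Qed.
Let t0 : 0 < (p - 1)^-1. Proof. by rewrite invr_gt0. Qed.
Let q0 : 0 < q. Proof. exact: divr_gt0. Qed.
Let qE : q = (p - 1)^-1 + 1.
Proof. by rewrite /q; field; rewrite gt_eqF. Qed.
Let pqE : q^-1 + p^-1 = 1.
Proof. by rewrite /q; field; rewrite !gt_eqF. Qed.

(** The gradient of the potential; its inverse [primalmap] is the gradient of the conjugate
    potential [|th|_q^q / q]. *)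
Definition dualmap d (w : 'rV[R]_d) : 'rV[R]_d := \row_j spow (p - 1) (w 0 j).
Definition primalmap d (th : 'rV[R]_d) : 'rV[R]_d := \row_j spow (p - 1)^-1 (th 0 j).

Lemma dualmapK d (w : 'rV[R]_d) : primalmap (dualmap w) = w.
Proof. by apply/rowP => j; rewrite !mxE spowK. Qed.

Lemma dualmap_pGD_step d eta (L : 'rV[R]_d -> R) w :
  dualmap (pGD_step p eta L w) = dualmap w - eta *: grad L w.
Proof. by apply/rowP => j; rewrite !mxE -/(spow _ _) -/(spow _ _) spowVK. Qed.

Lemma lpnorm_primalmap d (th : 'rV[R]_d) :
  lpnorm p (primalmap th) = lpnorm q th `^ (p - 1)^-1.
Proof.
rewrite [LHS]lpnormE.
under eq_bigr do rewrite mxE normr_spow ?gt_eqF// -powRrM mulrC -/q.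
rewrite -(lpnorm_powR th (lt0r_neq0 q0)) -powRrM; congr (_ `^ _).
by rewrite /q; field; rewrite !gt_eqF.
Qed.

Definition unitdual d (th : 'rV[R]_d) : 'rV[R]_d :=
  (lpnorm p (primalmap th))^-1 *: primalmap th.

(** Homogeneity of degree [0] made explicit: only [th] divided by its norm enters, through a
    continuous function of each coordinate. *)
Lemma unitdualE d (th : 'rV[R]_d) j : 0 < lpnorm q th ->
  unitdual th 0 j = spow (p - 1)^-1 (th 0 j / lpnorm q th).
Proof.
move=> N0; rewrite !mxE lpnorm_primalmap [th 0 j / _]mulrC.
rewrite spowM ?gt_eqF ?invr_ge0 ?(ltW N0)//.
by rewrite -[in RHS]powR_inv1 ?(ltW N0)// powRAC powR_inv1// powR_ge0.
Qed.

Lemma dotv_unitdual d (th : 'rV[R]_d) : 0 < lpnorm q th ->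
  dotv th (unitdual th) = lpnorm q th.
Proof.
move=> N0; rewrite dotvZr /dotv lpnorm_primalmap.
under eq_bigr do rewrite mxE mulr_spow// -qE.
rewrite -(lpnorm_powR th (lt0r_neq0 q0)); move: (lpnorm q th) N0 => N N0.
have Nq : N `^ q = N `^ (p - 1)^-1 * N.
  by rewrite qE powRD ?(gt_eqF N0) ?implybT// powRr1 ?(ltW N0).
by rewrite Nq mulKf// gt_eqF// powR_gt0.
Qed.

Lemma lpnorm_unitdual d (th : 'rV[R]_d) : 0 < lpnorm q th -> lpnorm p (unitdual th) = 1.
Proof.
move=> N0; rewrite lpnormZ ?gt_eqF// normfV ger0_norm ?lpnorm_ge0// mulVf//.
by rewrite lpnorm_primalmap gt_eqF// powR_gt0.
Qed.

Lemma ler_unitdual d (th : 'rV[R]_d) j : 0 < lpnorm q th -> `|unitdual th 0 j| <= 1.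
Proof. by move=> N0; rewrite -(lpnorm_unitdual N0); apply: ler_lpnorm. Qed.

(** [unitdual th'] is a subgradient of the norm at [th']: it attains equality in Hoelder's
    inequality there and, having norm [1], satisfies the inequality at [th]. *)
Lemma lpnorm_tangent d (th th' : 'rV[R]_d) : 0 < lpnorm q th' ->
  lpnorm q th' - lpnorm q th <= dotv (th' - th) (unitdual th').
Proof.
move=> N0; rewrite dotvBl dotv_unitdual// lerB//.
by rewrite -[leRHS]mulr1 -(lpnorm_unitdual N0) hoelder_dotv.
Qed.

Lemma lpnorm_sub_le d (th th' : 'rV[R]_d) : 0 < lpnorm q th' ->
  lpnorm q th' - lpnorm q th <= l1norm (th' - th).
Proof.
move=> N0; apply: le_trans (lpnorm_tangent _ N0) _; apply: le_trans (ler_norm _) _.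
by rewrite -[leRHS]mul1r ler_dotv_l1norm// => j; exact: ler_unitdual.
Qed.

(* The gradient of the dual norm is [0]-homogeneous, hence uniformly continuous at infinity. *)
Lemma unitdual_near d e : 0 < e -> exists2 M, 0 < M &
  forall th del : 'rV[R]_d, M <= lpnorm q th -> l1norm del <= 1 ->
  0 < lpnorm q (th + del) /\
  forall j, `|unitdual (th + del) 0 j - unitdual th 0 j| <= e.
Proof.
move=> e0; have [r r0 hr] := heine_cantor (-1) 1 (continuous_spow t0) e0.
(* The new norm [N'] stays above [2 / r], and the numerator of the change in a normalized coordinate
   is at most [2], so that change is below [r]. *)
exists (2 + 2 / r); first by rewrite addr_gt0// divr_gt0.
move=> th del NM d1; set N := lpnorm q th in NM *; set N' := lpnorm q (th + del).
have r20 : 0 < 2 / r by rewrite divr_gt0.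
have N0 : 0 < N by lra.
have h1 : N - N' <= l1norm del.
  have := @lpnorm_sub_le _ (th + del) th N0.
  by rewrite opprD addrA subrr add0r l1normN.
have N'1 : 2 / r < N' by lra.
have N'0 : 0 < N' by lra.
have h2 : N' - N <= l1norm del.
  by have := @lpnorm_sub_le _ th (th + del) N'0; rewrite addrAC subrr add0r.
split=> // j; rewrite !unitdualE// distrC ltW// hr//.
  have : `|th 0 j| <= N := ler_lpnorm _ _ q0.
  by rewrite ler_norml => /andP[h3 h4]; rewrite ler_pdivlMr// ler_pdivrMr// mulN1r mul1r h3.
have -> : th 0 j / N - (th + del) 0 j / N' =
    ((th 0 j / N) * (N' - N) - del 0 j) / N'.
  by rewrite mxE; field; rewrite !gt_eqF.
rewrite normf_div (gtr0_norm N'0) ltr_pdivrMr//.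
apply: (@le_lt_trans _ _ 2); last by rewrite mulrC -ltr_pdivrMr.
apply: le_trans (ler_normB _ _) _; rewrite normrM normf_div (gtr0_norm N0).
have h5 : `|th 0 j| / N <= 1 by rewrite ler_pdivrMr// mul1r ler_lpnorm.
have h6 : `|N' - N| <= 1 by rewrite ler_norml; lra.
have h7 : `|del 0 j| <= 1 := le_trans (le_l1norm _ _) d1.
have : `|th 0 j| / N * `|N' - N| <= 1 * 1 by apply: ler_pM => //; rewrite divr_ge0// ltW.
lra.
Qed.

(** * Stability of equality in the Young and Hoelder inequalities *)

Lemma young_spow (a b : R) : a * b <= `|a| `^ q / q + `|b| `^ p / p.
Proof.
apply: le_trans (ler_norm _) _; rewrite normrM.
exact: conjugate_powR.
Qed.

Lemma young_spow_eq (a : R) :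
  let b := spow (p - 1)^-1 a in a * b = `|a| `^ q / q + `|b| `^ p / p.
Proof.
rewrite /= mulr_spow// -qE normr_spow ?gt_eqF// -powRrM mulrC mulrC.
have -> : (p - 1)^-1 * p = q by rewrite mulrC.
by rewrite -mulrDr pqE mulr1.
Qed.

(* Near-equality in Young's inequality forces [b] close to [spow _ a]: past the dual point [a']
   of [b + e / 2] (or [b - e / 2]), the defect grows at least linearly in [a - a']. *)
Lemma young_stable (b e : R) : 0 < e -> exists2 del, 0 < del &
  forall a, `|a| `^ q / q + `|b| `^ p / p - a * b < del ->
  `|spow (p - 1)^-1 a - b| < e.
Proof.
move=> e0; pose c x := spow (p - 1) x.
have cK x : spow (p - 1)^-1 (c x) = x by exact: spowK.
pose d1 := e / 2 * (c (b + e) - c (b + e / 2)).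
pose d2 := e / 2 * (c (b - e / 2) - c (b - e)).
have d10 : 0 < d1 by rewrite mulr_gt0 ?divr_gt0// subr_gt0 spow_ltr//; lra.
have d20 : 0 < d2 by rewrite mulr_gt0 ?divr_gt0// subr_gt0 spow_ltr//; lra.
exists (Num.min d1 d2); first by rewrite lt_min d10.
(* As a function of [a] the Young defect is convex, is nonnegative at [a'], and has slope
   [spow (p - 1)^-1 a' - b] there. *)
have low a a' : (spow (p - 1)^-1 a' - b) * (a - a') <=
    `|a| `^ q / q + `|b| `^ p / p - a * b.
  have := young_spow a (spow (p - 1)^-1 a'); have /= := young_spow_eq a'.
  have := young_spow a' b; lra.
move=> a; rewrite lt_min => /andP[h1 h2]; rewrite ltNge; apply/negP => h.
have [ba|ba] := leP b (spow (p - 1)^-1 a).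
  have : b + e <= spow (p - 1)^-1 a by move: h; rewrite ger0_norm; lra.
  move=> /(spow_ler s0); rewrite spowVK// -/(c _) => h3.
  have := low a (c (b + e / 2)); rewrite cK.
  have : (b + e / 2 - b) * (c (b + e) - c (b + e / 2)) <=
         (b + e / 2 - b) * (a - c (b + e / 2)).
    by rewrite ler_wpM2l//; lra.
  move: h1; rewrite /d1; lra.
have : spow (p - 1)^-1 a <= b - e by move: h; rewrite ltr0_norm; lra.
move=> /(spow_ler s0); rewrite spowVK// -/(c _) => h3.
have := low a (c (b - e / 2)); rewrite cK.
have : (b - (b - e / 2)) * (c (b - e / 2) - c (b - e)) <=
       (b - (b - e / 2)) * (c (b - e / 2) - a).
  by rewrite ler_wpM2l//; lra.
move: h2; rewrite /d2; lra.
Qed.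

(** With [th] scaled to norm [1], the coordinatewise Young defects against [r] are nonnegative and
    sum to at most [1 - dotv th r / N], so near-equality makes each of them small. *)
Lemma unitdual_stable d (r : 'rV[R]_d) e : lpnorm p r <= 1 -> 0 < e ->
  exists2 del, 0 < del & forall th : 'rV[R]_d, 0 < lpnorm q th ->
    (1 - del) * lpnorm q th < dotv th r -> forall j, `|unitdual th 0 j - r 0 j| < e.
Proof.
move=> r1 e0.
have h j := young_stable (r 0 j) e0.
pose del j := s2val (cid2 (h j)).
have del0 j : 0 < del j := s2valP (cid2 (h j)).
have delP j := s2valP' (cid2 (h j)).
exists (\big[Num.min/1]_(j < d) del j).
  by apply: lt_bigmin.
move=> th N0 hth j; rewrite unitdualE//; apply: delP.
set N := lpnorm q th in N0 hth *.
have unit : \sum_(i < d) `|th 0 i / N| `^ q = 1.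
  under eq_bigr do rewrite normrM powRM// normfV (gtr0_norm N0).
  rewrite -mulr_suml -(lpnorm_powR th (lt0r_neq0 q0)) -/N -powRM ?invr_ge0 ?(ltW N0)//.
  by rewrite divff ?gt_eqF// powR1.
pose Y i := `|th 0 i / N| `^ q / q + `|r 0 i| `^ p / p - th 0 i / N * r 0 i.
have Y0 i : 0 <= Y i by rewrite subr_ge0 young_spow.
have sY : \sum_(i < d) Y i < \big[Num.min/1]_(j < d) del j.
  rewrite !big_split/= sumrN -!mulr_suml unit mul1r.
  have -> : \sum_(i < d) th 0 i / N * r 0 i = dotv th r / N.
    by rewrite mulr_suml; apply: eq_bigr => i _; rewrite mulrAC.
  have : 1 - \big[Num.min/1]_(j < d) del j < dotv th r / N by rewrite ltr_pdivlMr.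
  have : (\sum_(i < d) `|r 0 i| `^ p) / p <= p^-1.
    by rewrite ler_piMl ?invr_ge0 ?(ltW p0)// -lpnorm_le1.
  by move: pqE; lra.
apply: le_lt_trans (lt_le_trans sY _); last exact: bigmin_le_cond.
by rewrite (bigD1 j)//= -/(Y j) lerDl sumr_ge0.
Qed.

End MirrorMap.

(** * Convex losses *)

Section LossSlope.
Variables (R : realType) (ell : R -> R).

(** Convexity bounds the difference quotients from [x] towards [y], for steps [h] in [(0, 1]], by
    [ell y - ell x]; a larger directional derivative would violate this for some small [h]. *)
Lemma convex_tangent (x y : R) : convex_fun ell -> derivable ell x 1 ->
  ell x + 'D_1 ell x * (y - x) <= ell y.
Proof.
move=> cvx /derivable1_diffP dx.
have Dv : 'D_(y - x) ell x = 'D_1 ell x * (y - x).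
  by rewrite !deriveE// -[y - x in LHS]mulr1 [_ * 1]/(_ *: 1) linearZ/= mulrC.
rewrite -Dv -lerBrDl leNgt; apply/negP => hlt.
have /= /cvgr_gt/(_ _ hlt) := @diff_derivable _ _ _ ell x (y - x) dx.
move=> /nbhs_ballP[e /= e0 he].
pose h := Num.min (e / 2) 1.
have h0 : 0 < h by rewrite lt_min divr_gt0 ?ltr01.
have h1 : h <= 1 by rewrite ge_min lexx orbT.
have hlte : h < e.
  by rewrite gt_min; apply/orP; left; rewrite ltr_pdivrMr// ltr_pMr// ltr1n.
have /= := he h; rewrite /ball/= sub0r normrN gtr0_norm// => /(_ hlte).
rewrite gt_eqF// => /(_ isT); rewrite [_ *: _]mulrC ltr_pdivlMr// => hh.
have := cvx y x h; rewrite h1 (ltW h0) => /(_ isT).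
have -> : h * y + (1 - h) * x = h *: (y - x) + x by rewrite /GRing.scale/=; ring.
move: hh; lra.
Qed.

End LossSlope.

(** * Decay of the slope, where [a] stands for [- ell'] and is known through its sign and the
    tangent inequality *)

Section Decay.
Variables (R : realType) (ell a : R -> R).
Hypothesis a_gt0 : forall z, 0 < a z.
Hypothesis ell_ge0 : forall z, 0 <= ell z.
Hypothesis ell_tangent : forall z u, ell z - a z * (u - z) <= ell u.

Lemma slope_noninc x y : x <= y -> a y <= a x.
Proof.
rewrite le_eqVlt => /predU1P[->//|xy].
have := ell_tangent x y; have := ell_tangent y x.
have : 0 < y - x by rewrite subr_gt0.
move=> h0 h1 h2; rewrite -(ler_pM2r h0); lra.
Qed.

Lemma loss_noninc x y : x <= y -> ell y <= ell x.
Proof.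
move=> xy; have := ell_tangent y x.
have : 0 <= a y * (y - x) by rewrite mulr_ge0 ?subr_ge0// ltW.
lra.
Qed.

(* Otherwise [z * a z] would stay bounded below along [lam ^+ k * z0],
   although [a] is integrable at infinity. *)
Lemma slope_decay K lam z0 : 0 < K -> K <= lam -> 2 <= lam -> 0 < z0 ->
  exists2 z, z0 <= z & K * a (lam * z) < a z.
Proof.
move=> K0 Klam lam2 z00; apply: contrapT => hn.
have h z : z0 <= z -> a z <= K * a (lam * z).
  by move=> zz; rewrite leNgt; apply/negP => h; apply: hn; exists z.
pose Z k := lam ^+ k * z0.
have ZS k : Z k.+1 = lam * Z k by rewrite /Z exprS mulrA.
have Z0 k : z0 <= Z k.
  by rewrite /Z ler_peMl ?(ltW z00)// exprn_ege1//; lra.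
pose c := z0 * a z0.
have c0 : 0 < c by rewrite mulr_gt0.
have hc k : c <= Z k * a (Z k).
  elim: k => [|k IH]; first by rewrite /Z expr0 mul1r.
  apply: le_trans IH _; rewrite ZS -mulrA mulrCA ler_pM2l; last exact: lt_le_trans (Z0 k).
  by apply: le_trans (h _ (Z0 k)) _; rewrite ler_pM2r.
(* The tangent at [Z k.+1] makes [ell] fall by at least [c / 2] from [Z k.+1 / 2] to [Z k.+1], and
   [2 <= lam] places [Z k.+1 / 2] beyond [Z k]. *)
have drop k : ell (Z k) <= ell z0 - k%:R * (c / 2).
  elim: k => [|k IH]; first by rewrite mul0r subr0 /Z expr0 mul1r.
  have h1 := ell_tangent (Z k.+1) (Z k.+1 / 2).
  have h2 : ell (Z k.+1 / 2) <= ell (Z k).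
    apply: loss_noninc; rewrite ZS ler_pdivlMr// mulrC ler_wpM2r//.
    by rewrite (le_trans (ltW z00)).
  have h3 := hc k.+1; rewrite -natr1; nra.
have [k hk] : exists k, ell z0 / (c / 2) < k%:R.
  by exists (Num.truncn (ell z0 / (c / 2))).+1; rewrite truncnS_gt.
move: hk; rewrite ltr_pdivrMr ?divr_gt0//.
have := drop k; have := ell_ge0 (Z k); lra.
Qed.

End Decay.

(** * Dual orbits on separable data *)

Section Separable.
Variables (R : realType) (p : R) (n d : nat) (ell a : R -> R).
Variables (v : 'I_n -> 'rV[R]_d) (ws : 'rV[R]_d) (gam D : R).
Hypothesis p1 : 1 < p.
Let q := p / (p - 1).
Hypothesis n0 : (0 < n)%N.
Hypothesis a_gt0 : forall z, 0 < a z.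
Hypothesis ell_ge0 : forall z, 0 <= ell z.
Hypothesis ell_tangent : forall z u, ell z - a z * (u - z) <= ell u.
Hypothesis ws1 : lpnorm p ws <= 1.
Hypothesis gam0 : 0 < gam.
Hypothesis D0 : 0 < D.
Hypothesis wsv : forall i, gam <= dotv ws (v i).
Hypothesis vD : forall i, l1norm (v i) <= D.

Let p0 : 0 < p. Proof. exact: lt_trans ltr01 p1. Qed.
Let s0 : 0 < p - 1. Proof. by rewrite subr_gt0. Qed.
Let q0 : 0 < q. Proof. exact: divr_gt0. Qed.
Let q1 : 1 < q. Proof. by rewrite /q ltr_pdivlMr// mul1r gtrBl. Qed.
Let qq : q / (q - 1) = p.
Proof. by rewrite /q; field; rewrite !gt_eqF//; lra. Qed.
Let pqE : p^-1 + q^-1 = 1.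
Proof. by rewrite /q; field; rewrite !gt_eqF. Qed.

(** The labels are absorbed into [v i], which becomes [y i *: x i]. The factor [1 / n] is dropped
    here, as it does not affect minimality. *)
Definition total_loss (w : 'rV[R]_d) : R := \sum_(i < n) ell (dotv w (v i)).
Definition neg_grad (w : 'rV[R]_d) : 'rV[R]_d :=
  n%:R^-1 *: \sum_(i < n) a (dotv w (v i)) *: v i.

Lemma dotv_neg_grad w u :
  dotv (neg_grad w) u = n%:R^-1 * \sum_(i < n) a (dotv w (v i)) * dotv u (v i).
Proof.
rewrite dotvZl dotv_suml; congr (_ * _); apply: eq_bigr => i _.
by rewrite dotvZl [dotv (v i) u]dotvC.
Qed.

(** By convexity, the pairing of [neg_grad w] with [u - w] is at least the loss decrease from [w] to
    [u], up to the factor [1 / n]. *)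
Lemma dotv_neg_grad_le w u : total_loss u <= total_loss w ->
  dotv (neg_grad w) w <= dotv (neg_grad w) u.
Proof.
move=> uw; rewrite !dotv_neg_grad ler_wpM2l ?invr_ge0//.
rewrite -subr_ge0 -sumrB.
have : \sum_(i < n) (ell (dotv w (v i)) - ell (dotv u (v i))) <=
  \sum_(i < n) (a (dotv w (v i)) * dotv u (v i) - a (dotv w (v i)) * dotv w (v i)).
  by apply: ler_sum => i _; have := ell_tangent (dotv w (v i)) (dotv u (v i)); lra.
by apply: le_trans; rewrite sumrB subr_ge0.
Qed.

(** The gradient is a positive combination of data on which [ws] has margin at least [gam]; there is
    no cancellation along [ws], so this pairing dominates every error proportional to the step. *)
Lemma l1norm_neg_grad w : l1norm (neg_grad w) <= D / gam * dotv (neg_grad w) ws.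
Proof.
rewrite dotv_neg_grad l1normZ ger0_norm ?invr_ge0// mulrCA ler_wpM2l ?invr_ge0//.
apply: le_trans (l1norm_sum _) _; rewrite mulr_sumr; apply: ler_sum => i _.
rewrite l1normZ gtr0_norm// mulrCA ler_wpM2l ?(ltW (a_gt0 _))//.
apply: le_trans (vD i) _; rewrite -mulrA ler_peMr ?(ltW D0)//.
by rewrite mulrC ler_pdivlMr// mul1r.
Qed.

Lemma dotv_data_le (w : 'rV[R]_d) c i : 0 <= c -> (forall j, `|w 0 j| <= c) ->
  `|dotv w (v i)| <= c * D.
Proof.
move=> c0 wc; rewrite dotvC; apply: le_trans (ler_dotv_l1norm _ wc) _.
exact: ler_wpM2l.
Qed.

(* Minkowski through duality: the conjugate of [q] is [p]. *)
Lemma lpnorm_convex (x y : 'rV[R]_d) B s : lpnorm p x <= B -> lpnorm p y <= B ->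
  0 <= s <= 1 -> lpnorm p ((1 - s) *: x + s *: y) <= B.
Proof.
move=> xB yB /andP[s_ge0 s_le1]; have [z0|z0] := leP (lpnorm p ((1 - s) *: x + s *: y)) 0.
  by apply: le_trans z0 _; apply: le_trans xB; exact: lpnorm_ge0.
set z := _ + _ in z0 *.
have z0' : 0 < lpnorm (q / (q - 1)) z by rewrite qq.
have h w : lpnorm p w <= B -> dotv w (unitdual q z) <= B.
  move=> wB; apply: le_trans wB; rewrite -[leRHS]mulr1 -(lpnorm_unitdual q1 z0').
  exact: hoelder_dotv.
have := dotv_unitdual q1 z0'; rewrite qq => <-.
rewrite {1}/z dotvDl !dotvZl.
have := ler_wpM2l s_ge0 (h _ yB).
have : 0 <= 1 - s by lra.
move=> /ler_wpM2l/(_ _ _ (h _ xB)); lra.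
Qed.

(** * The regularization path and its limit direction *)

Variables (wbar : R -> 'rV[R]_d) (r : 'rV[R]_d).
Hypothesis wbar_le : forall B, 0 < B -> lpnorm p (wbar B) <= B.
Hypothesis wbar_min : forall B w, 0 < B -> lpnorm p w <= B ->
  total_loss (wbar B) <= total_loss w.
Hypothesis wbar_cvg : forall e, 0 < e -> exists2 B0, 0 < B0 &
  forall B j, B0 <= B -> `|(B^-1 *: wbar B) 0 j - r 0 j| <= e.

Lemma lpnorm_wbar B : 0 < B -> lpnorm p (B^-1 *: wbar B) <= 1.
Proof.
move=> B0; rewrite lpnormZ ?gt_eqF// normfV (gtr0_norm B0) mulrC.
by rewrite ler_pdivrMr// mul1r wbar_le.
Qed.

(** The scaled path stays in the unit ball. If [r] were outside, the functional [unitdual q r],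
    which attains the norm of [r], would separate it from the ball. *)
Lemma lpnorm_reg_direction : lpnorm p r <= 1.
Proof.
rewrite leNgt; apply/negP => r1; have r0 := lt_trans ltr01 r1.
have r0' : 0 < lpnorm (q / (q - 1)) r by rewrite qq.
pose c := l1norm (unitdual q r) + 1.
have c0 : 0 < c by rewrite ltr_wpDl// l1norm_ge0.
have [B B0 hB] := @wbar_cvg ((lpnorm p r - 1) / c / 2) ltac:(by rewrite !divr_gt0// subr_gt0).
have := dotv_unitdual q1 r0'; rewrite qq => h.
have h1 : dotv (B^-1 *: wbar B) (unitdual q r) <= 1.
  apply: le_trans (hoelder_dotv _ _ p0 q0 pqE) _.
  by rewrite -(lpnorm_unitdual q1 r0') ler_piMl ?lpnorm_ge0// lpnorm_wbar.
have h2 : `|dotv (unitdual q r) (r - B^-1 *: wbar B)| <=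
    (lpnorm p r - 1) / c / 2 * l1norm (unitdual q r).
  apply: ler_dotv_l1norm => j.
  by have := hB B j (lexx _); rewrite distrC !mxE.
have h3 : (lpnorm p r - 1) / c / 2 * l1norm (unitdual q r) <= (lpnorm p r - 1) / 2.
  rewrite mulrAC ler_wpM2r// -mulrA ler_piMr ?subr_ge0 ?(ltW r1)//.
  by rewrite mulrC ler_pdivrMr// mul1r /c lerDl.
move: h2; rewrite dotvBr ler_norml [dotv _ r]dotvC h dotvC => /andP[_ h2].
lra.
Qed.

(** The path point is compared with [w], a fraction [s] of the way to [B *: ws], which lies in the
    same ball. The tangent inequality is used at [w] itself, so the bound holds for each [s] without
    a limit [s -> 0]. *)
Lemma first_order_optimal B s : 0 < B -> 0 < s <= 1 ->
  \sum_(i < n) a (B * ((1 - s) * dotv (B^-1 *: wbar B) (v i) + s * dotv ws (v i))) *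
     (dotv ws (v i) - dotv (B^-1 *: wbar B) (v i)) <= 0.
Proof.
move=> B0 /andP[s_gt0 s1]; set u := B^-1 *: wbar B.
have uE : wbar B = B *: u by rewrite scalerA divff ?gt_eqF// scale1r.
clearbody u.
pose w := (1 - s) *: wbar B + s *: (B *: ws).
have wB : lpnorm p w <= B.
  apply: lpnorm_convex; rewrite ?wbar_le ?(ltW s_gt0)//.
  by rewrite lpnormZ ?gt_eqF// (gtr0_norm B0) ler_piMr// ltW.
have wE i : dotv w (v i) = B * ((1 - s) * dotv u (v i) + s * dotv ws (v i)).
  by rewrite dotvDl !dotvZl uE dotvZl; ring.
have := wbar_min B0 wB; rewrite -subr_ge0 -sumrB => h.
have : 0 <= \sum_(i < n) a (dotv w (v i)) * (s * B * (dotv u (v i) - dotv ws (v i))).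
  apply: le_trans h _; apply: ler_sum => i _.
  have := ell_tangent (dotv w (v i)) (dotv (wbar B) (v i)).
  have -> : dotv (wbar B) (v i) - dotv w (v i) = s * B * (dotv u (v i) - dotv ws (v i)).
    by rewrite wE uE dotvZl; ring.
  lra.
under eq_bigr do rewrite mulrCA.
rewrite -mulr_sumr pmulr_rge0 ?mulr_gt0// -oppr_le0 -sumrN => h2.
apply: le_trans h2; rewrite le_eqVlt; apply/orP; left; apply/eqP.
by apply: eq_bigr => i _; rewrite -wE; ring.
Qed.

(** If [r] had nonpositive margin at [i], then at a suitable radius [B] the slope at [i] would be at
    least [a z], while every datum on which the path beats [ws] has slope at most [a (lam * z)].
    Slope decay lets the term of [i] outweigh all the others, against first-order optimality. *)
Lemma reg_direction_margin : exists2 rho, 0 < rho & forall i, rho <= dotv r (v i).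
Proof.
suff pos i : 0 < dotv r (v i).
  exists (\big[Num.min/1]_(i < n) dotv r (v i)); first exact: lt_bigmin.
  by move=> i; exact: bigmin_le_cond.
rewrite ltNge; apply/negP => ri.
(* [K * (gam / 2) = n * (2 * D)]: the term of [i] has factor at least [gam / 2], the other terms
   have factors at least [- 2 * D]. *)
pose K := 4 * D * n%:R / gam.
have nR : 0 < n%:R :> R by rewrite ltr0n.
have K0 : 0 < K by rewrite divr_gt0// !mulr_gt0.
pose lam := K + 2; have lam0 : 0 < lam by rewrite /lam; lra.
pose del := gam / lam; have del0 : 0 < del by rewrite divr_gt0.
have dg : del <= gam / 2.
  by rewrite ler_wpM2l ?(ltW gam0)// lef_pV2 ?posrE// /lam; lra.
(* Mixing in this much of [ws] raises the margin at [i] by at most [del / 2]. *)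
pose s := Num.min 1 (del / 2 / D).
have s_gt0 : 0 < s by rewrite lt_min ltr01 !divr_gt0.
have s1 : s <= 1 by rewrite ge_min lexx.
have sD : s * D <= del / 2 by rewrite -ler_pdivlMr// ge_min lexx orbT.
have [B0 B00 hB] := @wbar_cvg (del / 2 / D) ltac:(by rewrite !divr_gt0).
have Klam : K <= lam by rewrite /lam; lra.
have lam2 : 2 <= lam by rewrite /lam; lra.
have Bd0 : 0 < B0 * del by rewrite mulr_gt0.
have [z z0 hz] := slope_decay a_gt0 ell_ge0 ell_tangent K0 Klam lam2 Bd0.
(* This radius gives both [B * del = z] and [B * gam = lam * z], and [z >= B0 * del] makes it at
   least [B0]. *)
pose B := z / del.
have BB0 : B0 <= B by rewrite ler_pdivlMr.
have B_gt0 : 0 < B := lt_le_trans B00 BB0.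
have Bz : B * del = z by rewrite divfK// gt_eqF.
have Bl : B * gam = lam * z by rewrite -Bz /del; field; rewrite gt_eqF.
pose u := B^-1 *: wbar B.
have u1 j : `|u 0 j| <= 1 := le_trans (ler_lpnorm _ _ p0) (lpnorm_wbar B_gt0).
have w1 j : `|ws 0 j| <= 1 := le_trans (ler_lpnorm _ _ p0) ws1.
have uD k : `|dotv u (v k)| <= D by rewrite -[leRHS]mul1r dotv_data_le.
have wD k : `|dotv ws (v k)| <= D by rewrite -[leRHS]mul1r dotv_data_le.
have ui : dotv u (v i) <= del / 2.
  have : `|dotv (v i) (u - r)| <= del / 2 / D * l1norm (v i).
    apply: ler_dotv_l1norm => j.
    have -> : (u - r) 0 j = u 0 j - r 0 j by rewrite !mxE.
    exact: hB.
  have : del / 2 / D * l1norm (v i) <= del / 2.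
    by rewrite mulrAC ler_pdivrMr// ler_wpM2l// divr_ge0 ?ltW.
  rewrite dotvC dotvBl ler_norml; lra.
have := @first_order_optimal B s B_gt0; rewrite s_gt0 s1 => /(_ isT) /=.
rewrite -/u (bigD1 i)//=.
set S := \sum_(k < n | _) _ => hS.
have t1 : a z * (gam / 2) <=
   a (B * ((1 - s) * dotv u (v i) + s * dotv ws (v i))) * (dotv ws (v i) - dotv u (v i)).
  apply: ler_pM; rewrite ?(ltW (a_gt0 _)) ?divr_ge0 ?(ltW gam0)//.
    apply: (slope_noninc ell_tangent); rewrite -Bz ler_pM2l//.
    have : s * dotv ws (v i) <= s * D.
      by rewrite ler_pM2l// (le_trans (ler_norm _)).
    have : (1 - s) * dotv u (v i) <= (1 - s) * (del / 2).
      by rewrite ler_wpM2l// subr_ge0.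
    have : 0 <= s * (del / 2) by apply: mulr_ge0; lra.
    lra.
  have := wsv i; lra.
have t2 : - (n%:R * (2 * D * a (lam * z))) <= S.
  apply: (@le_trans _ _ (\sum_(k < n | k != i) - (2 * D * a (lam * z)))).
    rewrite sumrN lerN2 sumr_const -[leLHS]mulr_natl ler_wpM2r//.
      by rewrite !mulr_ge0 ?(ltW D0) ?(ltW (a_gt0 _)).
    by rewrite ler_nat -[leqRHS]card_ord max_card.
  apply: ler_sum => k _.
  have [uk|uk] := leP (dotv u (v k)) (dotv ws (v k)).
    apply: (@le_trans _ _ 0).
      by rewrite oppr_le0 !mulr_ge0 ?(ltW D0) ?(ltW (a_gt0 _)).
    by rewrite mulr_ge0 ?subr_ge0 ?(ltW (a_gt0 _)).
  rewrite -[dotv ws (v k) - _]opprB mulrN lerN2 mulrC ler_pM ?subr_ge0 ?(ltW uk) ?(ltW (a_gt0 _))//.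
    have := uD k; have := wD k; rewrite !ler_norml; lra.
  apply: (slope_noninc ell_tangent); rewrite -Bl ler_pM2l//.
  have : (1 - s) * dotv ws (v k) <= (1 - s) * dotv u (v k).
    by rewrite ler_wpM2l ?subr_ge0// ltW.
  have := wsv k; lra.
have : a z * (gam / 2) <= n%:R * (2 * D * a (lam * z)) by lra.
have -> : n%:R * (2 * D * a (lam * z)) = K * a (lam * z) * (gam / 2).
  by rewrite /K; field; rewrite gt_eqF.
by rewrite ler_pM2r ?divr_gt0// leNgt hz.
Qed.

Lemma ler_normr_dotv (th w : 'rV[R]_d) : lpnorm p w <= 1 -> `|dotv th w| <= lpnorm q th.
Proof.
move=> w1; have qpE : q^-1 + p^-1 = 1 by rewrite addrC.
have h u : dotv u w <= lpnorm q u.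
  by apply: le_trans (hoelder_dotv _ _ q0 p0 qpE) _; rewrite ler_piMr ?lpnorm_ge0.
rewrite ler_norml h andbT lerNl -mulN1r -dotvZl; apply: le_trans (h _) _.
by rewrite lpnormZ ?gt_eqF// normrN normr1 mul1r.
Qed.

(** The threshold [M] is fixed before [eta]: the step size enters only through the bound [1] on the
    length of the step. *)
Lemma step_bound e : 0 < e -> exists2 M, 0 < M &
  forall (th : 'rV[R]_d) eta, 0 < eta -> M <= lpnorm q th ->
  let del := eta *: neg_grad (primalmap p th) in l1norm del <= 1 ->
  lpnorm q (th + del) - lpnorm q th <= dotv del (r + e *: ws).
Proof.
(* Two errors [eps * l1norm del] arise, from moving the gradient of the norm and from replacing the
   path by [r]; with this [eps] each costs at most [e / 2 * dotv del ws]. *)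
move=> e0; pose eps := e * gam / (2 * D).
have eps0 : 0 < eps by rewrite divr_gt0 ?mulr_gt0.
have [M1 M10 hM1] := unitdual_near p1 d eps0.
have [B0 B00 hB] := wbar_cvg eps0.
(* The second bound makes the primal norm at least [B0]. *)
exists (Num.max M1 (B0 `^ (p - 1))); first by rewrite lt_max M10.
move=> th eta eta0; rewrite ge_max => /andP[NM1 NM2] del del1.
have N0 : 0 < lpnorm q th := lt_le_trans M10 NM1.
have [N'0 hud] := hM1 th del NM1 del1.
set w := primalmap p th in del del1 N'0 hud *.
pose B := lpnorm p w.
have BE : B = lpnorm q th `^ (p - 1)^-1 by exact: lpnorm_primalmap.
have BB0 : B0 <= B.
  have B0E : B0 = (B0 `^ (p - 1)) `^ (p - 1)^-1.
    by rewrite -powRrM mulfV ?gt_eqF// powRr1// ltW.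
  rewrite BE B0E.
  by apply: ge0_ler_powR; rewrite ?nnegrE ?powR_ge0 ?lpnorm_ge0// invr_ge0 ltW.
have B_gt0 : 0 < B := lt_le_trans B00 BB0.
have t1 : lpnorm q (th + del) - lpnorm q th <= dotv del (unitdual p (th + del)).
  by have := lpnorm_tangent p1 th N'0; rewrite addrAC subrr add0r.
have t2 : dotv del (unitdual p (th + del)) - dotv del (unitdual p th) <= eps * l1norm del.
  rewrite -dotvBr; apply: le_trans (ler_norm _) _; apply: ler_dotv_l1norm => j.
  by have := hud j; rewrite !mxE.
have t3 : dotv del (unitdual p th) <= dotv del (B^-1 *: wbar B).
  rewrite /unitdual -/w -/B !dotvZr ler_wpM2l ?invr_ge0 ?(ltW B_gt0)// !(dotvZl eta).
  by rewrite ler_wpM2l ?(ltW eta0)// dotv_neg_grad_le// wbar_min.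
have t4 : dotv del (B^-1 *: wbar B) - dotv del r <= eps * l1norm del.
  rewrite -dotvBr; apply: le_trans (ler_norm _) _; apply: ler_dotv_l1norm => j.
  by have := hB B j BB0; rewrite !mxE.
have t5 : l1norm del <= D / gam * dotv del ws.
  by rewrite l1normZ (gtr0_norm eta0) dotvZl mulrCA ler_wpM2l ?(ltW eta0)// l1norm_neg_grad.
have t6 : eps * l1norm del <= e / 2 * dotv del ws.
  have := ler_wpM2l (ltW eps0) t5; rewrite mulrA.
  suff -> : eps * (D / gam) = e / 2 by [].
  by rewrite /eps; field; rewrite !gt_eqF.
rewrite dotvDr dotvZr; lra.
Qed.

Lemma l1norm_neg_grad_le w c : (forall i, c <= dotv w (v i)) ->
  l1norm (neg_grad w) <= a c * D.
Proof.
move=> cw; rewrite l1normZ ger0_norm ?invr_ge0//.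
have nR : 0 < n%:R :> R by rewrite ltr0n.
rewrite mulrC ler_pdivrMr//; apply: le_trans (l1norm_sum _) _.
have -> : a c * D * n%:R = \sum_(i < n) a c * D.
  by rewrite sumr_const card_ord mulr_natr.
apply: ler_sum => i _; rewrite l1normZ gtr0_norm// ler_pM ?l1norm_ge0 ?(ltW (a_gt0 _))//.
exact: (slope_noninc ell_tangent).
Qed.

(** * Dual orbits: bounded steps, divergence, limit direction *)

Definition dual_orbit (eta : R) (th : nat -> 'rV[R]_d) :=
  forall t, th t.+1 = th t + eta *: neg_grad (primalmap p (th t)).

(* [lpnorm q th - dotv th (r + e *: ws)] is bounded along the orbit; it keeps [th] either bounded
   or nearly aligned with [r], whose margin is positive, so the slopes never blow up. *)
Lemma dual_orbit_step_le1 th0 : exists2 eta0, 0 < eta0 &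
  forall eta th, 0 < eta <= eta0 -> dual_orbit eta th -> th 0%N = th0 ->
  forall t, l1norm (eta *: neg_grad (primalmap p (th t))) <= 1.
Proof.
have [rho rho0 hrho] := reg_direction_margin.
have r1 := lpnorm_reg_direction.
(* Coordinates within [rho / D] of those of [r] change a margin by at most [rho], so it stays
   nonnegative. *)
have rD0 : 0 < rho / D by rewrite divr_gt0.
have [del del0 hdel] := unitdual_stable p1 r1 rD0.
pose e := del / 2; have e0 : 0 < e by rewrite divr_gt0.
have [M1 M10 hM1] := step_bound e0.
pose M := Num.max M1 (lpnorm q th0).
have MM1 : M1 <= M by rewrite le_max lexx.
have Mth0 : lpnorm q th0 <= M by rewrite le_max lexx orbT.
(* [Phi] is at most [2 + e] times the norm, and [M + 1] bounds the norm after a step of length at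
   most [1] from norm below [M1]. *)
pose K := (2 + e) * (M + 1).
pose Phi (th : 'rV[R]_d) := lpnorm q th - dotv th (r + e *: ws).
have Phi_le th N : lpnorm q th <= N -> Phi th <= (2 + e) * N.
  move=> thN; rewrite /Phi dotvDr dotvZr.
  have := ler_normr_dotv th r1; have := ler_normr_dotv th ws1.
  rewrite !ler_norml => /andP[h1 h2] /andP[h3 h4].
  have := ler_wpM2l (ltW e0) h1; have := ler_wpM2l (ltW e0) thN; lra.
have K0 : 0 < K by rewrite mulr_gt0//; lra.
(* Above norm [N1] one has [K < e * lpnorm q th], so [Phi th <= K] gives alignment with [r] up to
   the fraction [2 * e = del]. *)
pose N1 := K / e + 1; have N10 : 0 < N1 by rewrite addr_gt0// divr_gt0.
pose c := N1 `^ (p - 1)^-1.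
have margin th i : Phi th <= K -> - (c * D) <= dotv (primalmap p th) (v i).
  move=> thK; have [NN|NN] := ltP N1 (lpnorm q th); last first.
    suff : `|dotv (primalmap p th) (v i)| <= c * D by rewrite ler_norml => /andP[].
    apply: dotv_data_le; rewrite ?powR_ge0// => j.
    rewrite mxE normr_spow ?gt_eqF ?invr_gt0//.
    apply: ge0_ler_powR; rewrite ?nnegrE ?invr_ge0 ?(ltW s0) ?(ltW N10)//.
    exact: le_trans (ler_lpnorm _ _ q0) NN.
  have N0 : 0 < lpnorm q th := lt_trans N10 NN.
  have al : (1 - del) * lpnorm q th < dotv th r.
    move: thK; rewrite /Phi dotvDr dotvZr.
    have := ler_normr_dotv th ws1; rewrite ler_norml => /andP[_ h2].
    have := ler_wpM2l (ltW e0) h2.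
    have : K < e * lpnorm q th.
      by rewrite mulrC -ltr_pdivrMr//; move: NN; rewrite /N1; lra.
    rewrite /e; lra.
  have hj := hdel th N0 al.
  have : 0 <= dotv (unitdual p th) (v i).
    have : `|dotv (v i) (unitdual p th - r)| <= rho / D * l1norm (v i).
      apply: ler_dotv_l1norm => j.
      have -> : (unitdual p th - r) 0 j = unitdual p th 0 j - r 0 j by rewrite !mxE.
      exact/ltW.
    have : rho / D * l1norm (v i) <= rho.
      by rewrite mulrAC ler_pdivrMr// ler_wpM2l// ltW.
    have := hrho i; rewrite dotvBr ![dotv (v i) _]dotvC ler_norml; lra.
  rewrite dotvZl pmulr_rge0 => [h|]; last first.
    by rewrite invr_gt0 lpnorm_primalmap// powR_gt0.
  by apply: le_trans h; rewrite oppr_le0 mulr_ge0 ?powR_ge0// ltW.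
exists (a (- (c * D)) * D)^-1; first by rewrite invr_gt0 mulr_gt0.
move=> eta th /andP[eta0 eta1] orb th00.
have small t : Phi (th t) <= K ->
    l1norm (eta *: neg_grad (primalmap p (th t))) <= 1.
  move=> h; rewrite l1normZ (gtr0_norm eta0).
  have := l1norm_neg_grad_le (fun i => margin _ i h).
  move=> /(ler_wpM2l (ltW eta0))/le_trans; apply.
  by rewrite -ler_pdivlMr ?mul1r// mulr_gt0.
(* [Phi <= K] is invariant: beyond [M1] the step bound makes [Phi] nonincreasing, below it the norm
   is at most [M + 1] after the step. *)
move=> t; apply: (small); elim: t => [|t IH].
  by rewrite th00 (le_trans (Phi_le _ _ Mth0))// ler_wpM2l ?lerDl// addr_ge0// ltW.
have d1 := small t IH; rewrite orb.
set del' := eta *: _ in d1 *.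
have [NM|NM] := leP M1 (lpnorm q (th t)).
  have := hM1 _ _ eta0 NM d1; rewrite -/del' => h.
  by apply: le_trans IH; rewrite /Phi dotvDl; lra.
apply: Phi_le; have [N0|N0] := leP (lpnorm q (th t + del')) 0.
  by apply: le_trans N0 _; lra.
have := lpnorm_sub_le p1 (th t) N0; rewrite addrAC subrr add0r => h.
lra.
Qed.

(** The pairing with [ws] never decreases and is at most the norm. If it stayed bounded, its
    increments would control the length of the orbit, the orbit would be bounded, the slopes would
    stay above some [a m], and the pairing would grow linearly. *)
Lemma dual_orbit_diverges eta th U : 0 < eta -> dual_orbit eta th ->
  exists T, forall t, (T <= t)%N -> U <= lpnorm q (th t).
Proof.
move=> eta0 orb.
have incr t : l1norm (th t.+1 - th t) <= D / gam * (dotv (th t.+1) ws - dotv (th t) ws).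
  rewrite -dotvBl orb addrAC subrr add0r l1normZ (gtr0_norm eta0) dotvZl.
  by rewrite mulrCA ler_wpM2l ?(ltW eta0)// l1norm_neg_grad.
have Dg0 : 0 < D / gam by rewrite divr_gt0.
have mono t t' : (t <= t')%N -> dotv (th t) ws <= dotv (th t') ws.
  move=> /subnK <-; elim: (t' - t)%N => [|k IH]//; apply: le_trans IH _.
  by rewrite -subr_ge0 -(pmulr_rge0 _ Dg0) addSn (le_trans (l1norm_ge0 _) (incr _)).
suff [T hT] : exists T, U <= dotv (th T) ws.
  exists T => t Tt; apply: le_trans hT _; apply: le_trans (mono _ _ Tt) _.
  by apply: le_trans (ler_norm _) _; exact: ler_normr_dotv.
apply: contrapT => hn.
have lt t : dotv (th t) ws < U.
  by rewrite ltNge; apply/negP => h; apply: hn; exists t.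
pose c := l1norm (th 0%N) + D / gam * (U - dotv (th 0%N) ws).
have c0 : 0 <= c.
  by rewrite addr_ge0 ?l1norm_ge0// mulr_ge0 ?(ltW Dg0)// subr_ge0 ltW.
have thc t : l1norm (th t) <= c.
  apply: (@le_trans _ _ (l1norm (th 0%N) + D / gam * (dotv (th t) ws - dotv (th 0%N) ws))).
    elim: t => [|t IH]; first by rewrite subrr mulr0 addr0.
    have := l1normD (th t) (th t.+1 - th t); rewrite addrC subrK.
    have := incr t; lra.
  by rewrite lerD2l ler_wpM2l ?(ltW Dg0)// lerB// ltW.
pose m := c `^ (p - 1)^-1 * D.
have zm t i : dotv (primalmap p (th t)) (v i) <= m.
  apply: le_trans (ler_norm _) _; apply: dotv_data_le; rewrite ?powR_ge0// => j.
  rewrite mxE normr_spow ?gt_eqF ?invr_gt0//.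
  apply: ge0_ler_powR; rewrite ?nnegrE ?invr_ge0 ?(ltW s0)//.
  exact: le_trans (le_l1norm _ _) (thc t).
have step t : eta * (a m * gam) <= dotv (th t.+1) ws - dotv (th t) ws.
  rewrite -dotvBl orb addrAC subrr add0r dotvZl ler_pM2l// dotv_neg_grad.
  have nR : 0 < n%:R :> R by rewrite ltr0n.
  rewrite [n%:R^-1 * _]mulrC ler_pdivlMr//.
  have -> : a m * gam * n%:R = \sum_(i < n) a m * gam.
    by rewrite sumr_const card_ord mulr_natr.
  apply: ler_sum => i _; rewrite ler_pM ?(ltW gam0) ?(ltW (a_gt0 _))//.
  exact: (slope_noninc ell_tangent).
have lin t : dotv (th 0%N) ws + t%:R * (eta * (a m * gam)) <= dotv (th t) ws.
  elim: t => [|t IH]; first by rewrite mul0r addr0.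
  by have := step t; rewrite -natr1; lra.
have st0 : 0 < eta * (a m * gam) by rewrite !mulr_gt0.
have := truncnS_gt ((U - dotv (th 0%N) ws) / (eta * (a m * gam))).
rewrite ltr_pdivrMr// => h.
set k := (_.+1)%N in h; have := lin k; have := lt k; lra.
Qed.

Lemma dual_orbit_direction eta th e : 0 < eta -> dual_orbit eta th ->
  (forall t, l1norm (eta *: neg_grad (primalmap p (th t))) <= 1) -> 0 < e ->
  exists T, forall t j, (T <= t)%N -> `|unitdual p (th t) 0 j - r 0 j| < e.
Proof.
move=> eta0 orb step1 e_gt0.
have r1 := lpnorm_reg_direction.
have [del del0 hdel] := unitdual_stable p1 r1 e_gt0.
pose e' := del / 2; have e'0 : 0 < e' by rewrite divr_gt0.
have [M M0 hM] := step_bound e'0.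
have [T hT] := @dual_orbit_diverges eta th M eta0 orb.
pose Phi t := lpnorm q (th t) - dotv (th t) (r + e' *: ws).
have PhiT t : (T <= t)%N -> Phi t <= Phi T.
  move=> /subnK <-; elim: (t - T)%N => [|k IH]//; apply: le_trans IH.
  rewrite addSn /Phi orb dotvDl.
  have := hM _ _ eta0 (hT (k + T)%N (leq_addl _ _)) (step1 _); lra.
(* Beyond this norm [Phi T] costs less than the fraction [e'], and the [ws] term costs at most
   another [e'], which makes [del] in all. *)
pose N1 := `|Phi T| / e' + 1.
have N10 : 0 < N1 by rewrite ltr_wpDl// divr_ge0// ltW.
have [T' hT'] := @dual_orbit_diverges eta th N1 eta0 orb.
exists (maxn T T') => t j; rewrite geq_max => /andP[Tt T't].
have NN := hT' _ T't; apply: hdel; first exact: lt_le_trans NN.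
have := PhiT _ Tt; rewrite {1}/Phi dotvDr dotvZr.
have := ler_normr_dotv (th t) ws1; rewrite ler_norml => /andP[_ h2].
have := ler_wpM2l (ltW e'0) h2.
have : `|Phi T| < e' * lpnorm q (th t).
  by rewrite mulrC -ltr_pdivrMr//; move: NN; rewrite /N1; lra.
have := ler_norm (Phi T); rewrite /e'; lra.
Qed.

End Separable.

(** * The gradient of the empirical loss *)

Section Reduction.
Variables (R : realType) (n d : nat) (ell : R -> R).

Lemma derive_affine (c z : R) : (forall u, derivable ell u 1) ->
  is_derive (0 : R) 1 (fun h : R => ell (h * c + z)) (c * 'D_1 ell z).
Proof.
move=> del.
have h1 : is_derive (0 : R) 1 (fun h : R => h * c + z) c.
  by apply: is_derive_eq; rewrite ?mulr1 ?scaler0 ?addr0 ?add0r /GRing.scale/= ?mulr1.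
have h2 : is_derive (0 * c + z) 1 ell ('D_1 ell z).
  by rewrite mul0r add0r; exact/derivableP.
have := @is_derive1_comp R ell (fun h : R => h * c + z) 0 _ _ h2 h1.
by rewrite mulrC.
Qed.

Lemma grad_emp_loss (x : 'I_n -> 'rV[R]_d) (y : 'I_n -> R) w :
  (forall u, derivable ell u 1) ->
  grad (emp_loss ell x y) w =
  - neg_grad (fun z => - 'D_1 ell z) (fun i => y i *: x i) w.
Proof.
move=> dell; apply/rowP => j; rewrite mxE.
pose z i := y i * dotv w (x i); pose c i := y i * x i 0 j.
have zE i : dotv w (y i *: x i) = z i by rewrite dotvZr.
(* The partial derivative is rewritten as the derivative at [0] of a function of one real
   variable. *)
transitivity ('D_1 (fun h : R => n%:R^-1 * \sum_(i < n) ell (h * c i + z i)) (0 : R)).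
  rewrite /derive; congr (lim (_ @ 0^')); apply/funext => h /=.
  congr (h^-1 *: (_ - _)); rewrite /emp_loss; congr (_ * _); apply: eq_bigr => i _.
    rewrite [h *: 1]mulr1 addr0 dotvDl dotvZl; congr ell.
    have -> : dotv (delta_mx 0 j) (x i) = x i 0 j.
      rewrite /dotv (bigD1 j)//= mxE !eqxx mul1r big1 ?addr0// => k kj.
      by rewrite mxE (negbTE kj) andbF mul0r.
    by rewrite /c /z; ring.
  by rewrite mul0r add0r.
have hs : is_derive (0 : R) 1 (\sum_(i < n) (fun h : R => ell (h * c i + z i)))
    (\sum_(i < n) c i * 'D_1 ell (z i)).
  by apply: is_derive_sum => i; exact: derive_affine.
have -> : (fun h : R => n%:R^-1 * \sum_(i < n) ell (h * c i + z i)) =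
    n%:R^-1 *: (\sum_(i < n) (fun h : R => ell (h * c i + z i))).
  by apply/funext => h; rewrite fctE fct_sumE.
rewrite derive_val !mxE -mulrN summxE; congr (_ * _).
rewrite -sumrN; apply: eq_bigr => i _; rewrite !mxE zE /c mulNr opprK mulrC; ring.
Qed.

End Reduction.

Lemma pnorm_lpnorm (R : realType) (d : nat) (p : R) : @pnorm R d p = lpnorm p.
Proof. by rewrite lpnorm.unlock. Qed.

Theorem theorem3 (R : realType) (n d : nat) (p : R) (x : 'I_n -> 'rV[R]_d)
  (y : 'I_n -> R) (ell : R -> R) (C : R) (rdir : 'rV[R]_d) (w0 : 'rV[R]_d) :
  (0 < n)%N ->
  1 < p ->
  (forall i, y i = 1 \/ y i = -1) ->
  (exists wstar : 'rV[R]_d, forall i, Num.sg (dotv wstar (x i)) = y i) ->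
  (forall i, pnorm (p / (p - 1)) (x i) < C) ->
  admissible_loss ell ->
  is_reg_direction p (emp_loss ell x y) rdir ->
  exists eta0 : R, 0 < eta0 /\
    forall eta : R, 0 < eta -> eta <= eta0 ->
      (fun t => (pnorm p (pGD p eta (emp_loss ell x y) w0 t))^-1
                  *: pGD p eta (emp_loss ell x y) w0 t) @ \oo --> rdir.
Proof.
move=> n0 p1 y1 [ws' hws'] _ [dell elldec ellcvx _ [ell0 _]] [wbar [hpath hcvg]].
have p0 : 0 < p := lt_trans ltr01 p1.
pose v i := y i *: x i; pose a z := - 'D_1 ell z.
have tangent z u : ell z - a z * (u - z) <= ell u.
  by rewrite /a mulNr opprK convex_tangent.
(* Strict decrease between [z] and [z + 1] forces the tangent at [z] to slope downwards. *)
have a0 z : 0 < a z.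
  have := tangent z (z + 1); have := elldec z (z + 1) ltac:(by rewrite ltrDl).
  lra.
have emp_total w : emp_loss ell x y w = n%:R^-1 * total_loss ell v w.
  by rewrite /emp_loss; congr (_ * _); apply: eq_bigr => i _; rewrite dotvZr.
(* The pairing is the absolute value of [dotv ws' (x i)], which is nonzero because its sign is [1]
   or [-1]. *)
have ws'v i : 0 < dotv ws' (v i).
  rewrite dotvZr -hws' -normrEsg normr_gt0; apply/eqP => h.
  by have := hws' i; rewrite h sgr0; case: (y1 i) => ->; lra.
pose N := lpnorm p ws' + 1.
have N0 : 0 < N by rewrite ltr_wpDl// lpnorm_ge0.
pose ws := N^-1 *: ws'.
have ws1 : lpnorm p ws <= 1.
  by rewrite lpnormZ ?gt_eqF// normfV (gtr0_norm N0) mulrC ler_pdivrMr// mul1r lerDl.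
have wsv i : 0 < dotv ws (v i) by rewrite dotvZl mulr_gt0// invr_gt0.
pose gam := \big[Num.min/1]_(i < n) dotv ws (v i).
have gam0 : 0 < gam by exact: lt_bigmin.
have gamP i : gam <= dotv ws (v i) by exact: bigmin_le_cond.
pose D := 1 + \sum_(i < n) l1norm (v i).
have D0 : 0 < D by rewrite ltr_pwDl// sumr_ge0// => i _; exact: l1norm_ge0.
have DP i : l1norm (v i) <= D.
  rewrite /D (bigD1 i)//= addrCA lerDl addr_ge0// sumr_ge0// => k _.
  exact: l1norm_ge0.
have wbar_le B : 0 < B -> lpnorm p (wbar B) <= B.
  by move=> /hpath[]; rewrite pnorm_lpnorm.
have wbar_min B w : 0 < B -> lpnorm p w <= B ->
    total_loss ell v (wbar B) <= total_loss ell v w.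
  move=> /hpath[_ h] wB; have := h w; rewrite pnorm_lpnorm => /(_ wB).
  by rewrite !emp_total ler_pM2l// invr_gt0 ltr0n.
have wbar_cvg e : 0 < e -> exists2 B0, 0 < B0 &
    forall B j, B0 <= B -> `|(B^-1 *: wbar B) 0 j - rdir 0 j| <= e.
  move=> e0; move/cvg_ballP : hcvg => /(_ e e0)[M [_ hM]].
  (* The limit at infinity speaks of [M < B] for an arbitrary real [M]; this threshold is positive
     and strictly above [M]. *)
  exists (Num.max M 0 + 1); first by rewrite ltr_wpDl// le_max lexx orbT.
  move=> B j BM; have /hM[_ /(_ 0 j)] : M < B.
    by apply: lt_le_trans BM; rewrite ltr_pwDr// le_max lexx.
  by rewrite /ball/= distrC => /ltW.
have [eta0 eta00 heta] := dual_orbit_step_le1 p1 n0 a0 ell0 tangent ws1 gam0 D0 gamP DP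
  wbar_le wbar_min wbar_cvg (dualmap p w0).
exists eta0; split=> // eta eta_gt0 eta_le.
pose w t := pGD p eta (emp_loss ell x y) w0 t.
pose th t := dualmap p (w t).
have orb : dual_orbit p a v eta th.
  move=> t; rewrite /th dualmapK// /w /pGD iterS dualmap_pGD_step//.
  by rewrite grad_emp_loss// scalerN opprK.
have step1 := heta eta th ltac:(by rewrite eta_gt0) orb erefl.
apply/cvg_ballP => e e0.
have [T hT] := dual_orbit_direction p1 n0 a0 tangent ws1 gam0 D0 gamP DP
  wbar_le wbar_min wbar_cvg eta_gt0 orb step1 e0.
exists T => //= t /= Tt; split=> // i j; rewrite ord1.
have := hT t j Tt; rewrite /unitdual dualmapK// -pnorm_lpnorm => h.
by rewrite /ball/= distrC.
Qed.
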